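(* Let $(W,S)$ be a Coxeter system, $J\subseteq S$, $R=\mathbb{Z}[q^{1/2},q^{-1/2}]$, $t=q^{1/2}$, and let $M=M^J$ with basis $\{m_x\}_{x\in W^J}$, the elements ${}^{J}C'_y$ ($y\in W^J$) and the elements ${}^{J}D'_{\mathbf{s}}$ be as defined in the context. Let $y\in W^J$, and let $\mathbf{s}=(s_1,\dots,s_k)$ be a sequence of elements of $S$ with $y=s_1s_2\cdots s_k$ a reduced product. Consider the following procedure. (1) Initialize a variable $F\in M$ to be ${}^{J}D'_{\mathbf{s}}$, and always write $F=\sum_{x\in W^J}f_x(t)\,\bigl(m_x/t^{\ell(x)}\bigr)$ with $f_x(t)\in R$. (2) If there is no $x\in W^J$ with $x<y$ such that the Laurent polynomial $f_x(t)$ has a nonzero term of non-negative degree in $t$, stop. (3) Otherwise, choose $x\in W^J$, $x<y$, of maximal length among those for which $f_x(t)$ has a nonzero term of non-negative degree in $t$. Put $f(t)=f_x(t)$ and $g(t)=f_{\ge 0}(t)+f_{>0}(t^{-1})$. Choose a sequence $\mathbf{s}'$ of elements of $S$ whose product is reduced and equal to $x$, and replace $F$ by $F-g(t)\,{}^{J}D'_{\mathbf{s}'}$. Return to step (2). Then, for any choices made, the procedure terminates after finitely many steps, and the final value of $F$ is ${}^{J}C'_y$. Moreover, at any stage of the procedure, no further replacement as in (3) can be made if and only if $F={}^{J}C'_y$.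
   Context: Let $(W,S)$ be a Coxeter system with length function $\ell$, identity $e$, and Bruhat--Chevalley order $\le$. Let $R=\mathbb{Z}[q^{1/2},q^{-1/2}]$ and $t=q^{1/2}$. The Hecke algebra $\mathcal{H}$ of $W$ is the free $R$-module with basis $T_x$ ($x\in W$), with identity $T_e$, and multiplication determined by $T_xT_y=T_{xy}$ if $\ell(xy)=\ell(x)+\ell(y)$ and $T_s^2=(q-1)T_s+qT_e$ for $s\in S$. Fix $J\subseteq S$ (possibly empty), let $W_J$ be the subgroup generated by $J$, and let $W^J$ be the set of distinguished (shortest) representatives of the right cosets $W_Jy$ in $W$. The right $\mathcal{H}$-module $M=M^J$ is free over $R$ with basis $\{m_x\}_{x\in W^J}$, where $m_x=m_eT_x$ for $x\in W^J$ and $m_eT_w=q^{\ell(w)}m_e$ for $w\in W_J$. Explicitly, for $x\in W^J$, $s\in S$: $m_xT_s=m_{xs}$ if $\ell(xs)>\ell(x)$ and $xs\in W^J$; $m_xT_s=q\,m_x$ if $\ell(xs)>\ell(x)$ and $xs\notin W^J$; $m_xT_s=q\,m_{xs}+(q-1)m_x$ if $\ell(xs)<\ell(x)$. The action of the commutative ring $R$ on $M$ is written on the left. Let $r\mapsto\overline{r}$ be the ring involution of $R$ sending $q^{1/2}$ to $q^{-1/2}$. The bar involution $m\mapsto\overline{m}$ on $M$ is the additive map satisfying $\overline{rm}=\overline{r}\,\overline{m}$, $\overline{m_e}=m_e$, and $\overline{mT_x}=\overline{m}\,\overline{T_x}$, where $\overline{T_x}=T_{x^{-1}}^{-1}$ ($r\in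 R$, $m\in M$, $x\in W$). Let $M^0=\{m\in M:\overline{m}=m\}$. By Deodhar, for each $y\in W^J$ there is a unique element ${}^{J}C'_y\in M^0$ of the form $${}^{J}C'_y=q^{-\ell(y)/2}\sum_{x\in W^J,\ x\le y}P^{J}_{x,y}(q)\,m_x$$ where the $P^{J}_{x,y}(q)$ are polynomials in $q$ with integer coefficients, of degree at most $(\ell(y)-\ell(x)-1)/2$ when $x<y$, and $P^{J}_{y,y}(q)=1$. Moreover, the elements ${}^{J}C'_y$ ($y\in W^J$) form a basis of $M^0$ over the ring $R^0=\{r\in R:\overline r=r\}$. For $s\in S$ put $C'_s=q^{-1/2}(T_e+T_s)\in\mathcal{H}$. For a finite sequence $\mathbf{s}=(s_1,\dots,s_k)$ of elements of $S$ whose product $s_1s_2\cdots s_k$ has length $k$ (i.e. is reduced), put ${}^{J}D'_{\mathbf{s}}=m_eC'_{s_1}C'_{s_2}\cdots C'_{s_k}\in M$ (equal to $m_e$ for the empty sequence). For $f(t)\in R$, write $f(t)=f_{\ge0}(t)+f_{<0}(t^{-1})$, where $f_{\ge 0}$ and $f_{<0}$ are polynomials with integer coefficients and $f_{<0}$ has zero constant term; $f_{>0}(t)$ denotes the positive degree part of $f_{\ge0}(t)$ (i.e. $f_{\ge0}(t)$ minus its constant term). *)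

(* Defs.v *)
From HB Require Import structures.
From mathcomp Require Import all_boot all_order all_algebra finmap.
From mathcomp Require Import boolp classical_sets fsbigop.
From mathcomp Require Import monalg.
From Stdlib Require Export Relation_Operators.

Set Implicit Arguments.
Unset Strict Implicit.
Unset Printing Implicit Defensive.

Import Order.TTheory GRing.Theory Num.Theory.

Local Open Scope fset_scope.
Local Open Scope classical_set_scope.
Local Open Scope ring_scope.

(* R = Z[t, t^-1] with t = q^(1/2), as the group ring of (int, +): f@_i is the
   coefficient of t^i.  [monalg] supplies the additive group and the
   coefficients; its product requires exponents without nontrivial units. *)
Definition laurent := {malg int[int]}.

HB.instance Definition _ := GRing.Zmodule.copy laurent {malg int[int]}.

Definition tX (i : int) : laurent := << i >>.

Definition laurent_mul (f g : laurent) : laurent :=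
  \sum_(i <- msupp f) \sum_(j <- msupp g) << f@_i * g@_j *g i + j >>.

Section LaurentRing.
Implicit Types f g h : laurent.

Lemma lmulw (d1 d2 : {fset int}) f g :
  (msupp f `<=` d1)%fset -> (msupp g `<=` d2)%fset ->
  laurent_mul f g = \sum_(i <- d1) \sum_(j <- d2) << f@_i * g@_j *g i + j >>.
Proof.
move=> le1 le2; rewrite /laurent_mul (big_fset_incl _ le1) /=.
  apply/eq_bigr=> i _; apply/big_fset_incl => // j _ /mcoeff_outdom ->.
  by rewrite mulr0 monalgU0.
move=> i _ /mcoeff_outdom fi.
by rewrite big1 // => j _; rewrite fi mul0r monalgU0.
Qed.

Lemma lmulC : commutative laurent_mul.
Proof.
move=> f g; rewrite /laurent_mul exchange_big /=.
by apply/eq_bigr=> i _; apply/eq_bigr=> j _; rewrite mulrC addrC.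
Qed.

Lemma lmul0 : left_zero 0 laurent_mul.
Proof. by move=> g; rewrite /laurent_mul msupp0 big_seq_fset0. Qed.

Lemma lmulDl : left_distributive laurent_mul +%R.
Proof.
move=> f g h.
rewrite (@lmulw _ _ _ h (msuppD_le f g) (fsubset_refl _)).
rewrite (@lmulw _ _ _ h (fsubsetUl _ (msupp g)) (fsubset_refl _)).
rewrite (@lmulw _ _ _ h (fsubsetUr (msupp f) _) (fsubset_refl _)).
rewrite -big_split /=; apply/eq_bigr=> i _.
rewrite -big_split /=; apply/eq_bigr=> j _.
by rewrite mcoeffD mulrDl monalgUD.
Qed.

Lemma lmulUU (c d i j : int) :
  laurent_mul << c *g i >> << d *g j >> = << c * d *g i + j >>.
Proof. by rewrite (lmulw msuppU_le msuppU_le) !big_seq_fset1 !mcoeffUU. Qed.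

Lemma lmul_suml (I : Type) (r : seq I) (F : I -> laurent) g :
  laurent_mul (\sum_(i <- r) F i) g = \sum_(i <- r) laurent_mul (F i) g.
Proof.
exact: (big_morph (laurent_mul^~ g) (fun _ _ => lmulDl _ _ _) (lmul0 g)).
Qed.

Lemma lmul_sumr (I : Type) (r : seq I) (F : I -> laurent) g :
  laurent_mul g (\sum_(i <- r) F i) = \sum_(i <- r) laurent_mul g (F i).
Proof. by rewrite lmulC lmul_suml; apply/eq_bigr=> i _; rewrite lmulC. Qed.

Lemma lmulA : associative laurent_mul.
Proof.
move=> f g h; rewrite (monalgE f) (monalgE g) (monalgE h).
rewrite !(lmul_suml (msupp f)); apply/eq_bigr=> i _.
rewrite (lmul_suml (msupp g)) !(lmul_sumr (msupp g)) (lmul_suml (msupp g)).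
apply/eq_bigr=> j _; rewrite !(lmul_sumr (msupp h)); apply/eq_bigr=> k _.
by rewrite !lmulUU mulrA addrA.
Qed.

Lemma lmul1 : left_id (tX 0) laurent_mul.
Proof.
move=> f; rewrite [in LHS](monalgE f) lmul_sumr [RHS]monalgE.
by apply/eq_bigr=> i _; rewrite lmulUU mul1r add0r.
Qed.

Lemma l1_neq0 : tX 0 != 0.
Proof. by rewrite monalgU_eq0. Qed.

End LaurentRing.

HB.instance Definition _ :=
  GRing.Zmodule_isComNzRing.Build laurent lmulA lmulC lmul1 lmulDl l1_neq0.

(* The substitution t |-> t^-1. *)
Definition lbar (f : laurent) : laurent :=
  \sum_(i <- msupp f) << f@_i *g - i >>.

Lemma lbarE (f : laurent) (k : int) : (lbar f)@_k = f@_(- k).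
Proof.
rewrite /lbar raddf_sum /=.
rewrite (eq_bigr (fun i => if i == - k then f@_i else 0)); last first.
  by move=> i _; rewrite mcoeffU eqr_oppLR; case: eqP.
rewrite -big_mkcond /=; case: (msuppP f (- k)) => [kf|kf].
  by rewrite -big_filter filter_pred1_uniq ?fset_uniq // big_seq1.
by rewrite big_seq_cond big1 // => i /andP[fi /eqP ik]; rewrite -ik fi in kf.
Qed.

Lemma lbarK : involutive lbar.
Proof. by move=> f; apply/malgP=> k; rewrite !lbarE opprK. Qed.

Lemma lbar_is_zmod_morphism : zmod_morphism lbar.
Proof.
by move=> f g; apply/malgP=> k; rewrite mcoeffB !lbarE mcoeffB.
Qed.

HB.instance Definition _ :=
  GRing.isZmodMorphism.Build laurent laurent lbar lbar_is_zmod_morphism.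

Lemma lbarU (c i : int) : lbar << c *g i >> = << c *g - i >>.
Proof. by apply/malgP=> k; rewrite lbarE !mcoeffU eqr_oppLR. Qed.

Lemma lbar_is_monoid_morphism : monoid_morphism lbar.
Proof.
split=> [|f g]; first by rewrite [LHS]lbarU oppr0.
have mE (a b : laurent) : a * b = laurent_mul a b by [].
rewrite !mE (monalgE f) (monalgE g) (lmul_suml (msupp f)) !raddf_sum.
rewrite (lmul_suml (msupp f)); apply/eq_bigr=> i _.
rewrite 2!(lmul_sumr (msupp g)) raddf_sum; apply/eq_bigr=> j _.
by rewrite /= lmulUU !lbarU lmulUU opprD.
Qed.

HB.instance Definition _ :=
  GRing.isMonoidMorphism.Build laurent laurent lbar lbar_is_monoid_morphism.

(* The parts of f of non-negative and of positive degree, f_{>=0}(t), f_{>0}(t). *)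
Definition lnneg (f : laurent) : laurent :=
  [malg i in msupp f => if 0 <= i then f@_i else 0].

Definition lpos (f : laurent) : laurent :=
  [malg i in msupp f => if 0 < i then f@_i else 0].

(* P(q), where q = t^2. *)
Definition at_q (P : {poly int}) : laurent := (map_poly intr P).[tX 2].

(* v = \sum_x c_x b_x, a finite sum over indices x in D. *)
Definition expansion (R : nzRingType) (M : lmodType R) (I : choiceType)
    (D : set I) (b : I -> M) (v : M) (c : {malg R[I]}) : Prop :=
  (forall x, x \in msupp c -> D x) /\ v = \sum_(x <- msupp c) c@_x *: b x.

Definition is_basis (R : nzRingType) (M : lmodType R) (I : choiceType)
    (D : set I) (b : I -> M) : Prop :=
  forall v : M, exists! c : {malg R[I]}, expansion D b v c.

Section Coxeter.
Context (W : groupType).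
Implicit Types (S J : set W) (x y w s r : W) (ss : seq W).

Definition is_subgroup (G : set W) : Prop :=
  [/\ G 1%g, forall x y, G x -> G y -> G (x * y)%g & forall x, G x -> G x^-1%g].

Definition generated (A : set W) : set W := smallest is_subgroup A.

(* W is presented by the generators S and the relations
   (s s')^m(s,s') = 1, where m(s,s) = 1 and m(s,s') = m(s',s) is at least 2 for
   distinct s and s'; the value 0 of m stands for infinity, the corresponding
   relation being vacuous.  The last clause is the universal property of the
   presentation; the uniqueness of phi follows from the first clause. *)
Definition coxeter_system S : Prop :=
  generated S = setT /\
  exists m : W -> W -> nat,
    [/\ forall s, S s -> m s s = 1%N,
        forall s s', S s -> S s' -> s <> s' -> m s s' = m s' s /\ m s s' <> 1%N,
        forall s s', S s -> S s' -> ((s * s') ^+ m s s' = 1)%g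
      & forall (G : groupType) (f : W -> G),
          (forall s s', S s -> S s' -> ((f s * f s') ^+ m s s' = 1)%g) ->
          exists phi : W -> G,
            {morph phi : x y / (x * y)%g} /\ forall s, S s -> phi s = f s].

Definition word_prod ss : W := foldr (fun s x => (s * x)%g) 1%g ss.

Definition word_for S x ss : Prop :=
  (forall s, s \in ss -> S s) /\ word_prod ss = x.

Definition is_length S x (n : nat) : Prop :=
  (exists ss, word_for S x ss /\ size ss = n) /\
  forall ss, word_for S x ss -> (n <= size ss)%N.

Definition len S x : nat := xget 0%N [set n | is_length S x n].

Definition reduced_word S x ss : Prop :=
  word_for S x ss /\ size ss = len S x.

Definition reflection S r : Prop := exists w s, S s /\ r = (w * s * w^-1)%g.

Definition bruhat_edge S x y : Prop :=
  (exists2 r, reflection S r & y = (x * r)%g) /\ (len S x < len S y)%N.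

Definition bruhat_le S : W -> W -> Prop := clos_refl_trans W (bruhat_edge S).

Definition bruhat_lt S x y : Prop := bruhat_le S x y /\ x <> y.

(* W^J: the elements of minimal length in their right coset W_J x. *)
Definition dist_reps S J : set W :=
  [set x | forall w, generated J w -> (len S x <= len S (w * x)%g)%N].

End Coxeter.

(* H is the Hecke algebra of (W, S), with standard basis T. *)
Record hecke_algebra (W : groupType) (S : set W)
    (H : unitAlgType laurent) (T : W -> H) : Prop := HeckeAlgebra {
  hecke_basis : is_basis setT T;
  hecke_one : T 1%g = 1;
  hecke_mul : forall x y, len S (x * y)%g = (len S x + len S y)%N ->
    T x * T y = T (x * y)%g;
  hecke_sqr : forall s, S s -> T s * T s = (tX 2 - 1) *: T s + tX 2 *: T 1%g
}.

(* act : M -> H -> M is a right module structure over the algebra H that is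
   compatible with the scalars written on the left. *)
Record right_module (R : comNzRingType) (H : algType R) (M : lmodType R)
    (act : M -> H -> M) : Prop := RightModule {
  actDl : forall u v h, act (u + v) h = act u h + act v h;
  actDr : forall v h k, act v (h + k) = act v h + act v k;
  actZl : forall (r : R) v h, act (r *: v) h = r *: act v h;
  actZr : forall (r : R) v h, act v (r *: h) = r *: act v h;
  act1 : forall v, act v 1 = v;
  actM : forall v h k, act v (h * k) = act (act v h) k
}.

(* M is the right H-module M^J, with basis m_x for x in W^J (the values of m
   outside W^J are irrelevant). *)
Record parabolic_module (W : groupType) (S J : set W)
    (H : unitAlgType laurent) (T : W -> H)
    (M : lmodType laurent) (act : M -> H -> M) (m : W -> M) : Prop :=
  ParabolicModule {
  pmod_right : right_module act;
  pmod_basis : is_basis (dist_reps S J) m;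
  pmod_m : forall x, dist_reps S J x -> m x = act (m 1%g) (T x);
  pmod_J : forall w, generated J w ->
    act (m 1%g) (T w) = tX 2 ^+ len S w *: m 1%g;
  pmod_up : forall x s, dist_reps S J x -> S s ->
    (len S x < len S (x * s)%g)%N -> dist_reps S J (x * s)%g ->
    act (m x) (T s) = m (x * s)%g;
  pmod_stay : forall x s, dist_reps S J x -> S s ->
    (len S x < len S (x * s)%g)%N -> ~ dist_reps S J (x * s)%g ->
    act (m x) (T s) = tX 2 *: m x;
  pmod_down : forall x s, dist_reps S J x -> S s ->
    (len S (x * s)%g < len S x)%N ->
    act (m x) (T s) = tX 2 *: m (x * s)%g + (tX 2 - 1) *: m x
}.

Record bar_involution (W : groupType) (H : unitAlgType laurent) (T : W -> H)
    (M : lmodType laurent) (act : M -> H -> M) (m : W -> M)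
    (bar : M -> M) : Prop := BarInvolution {
  barD : forall u v, bar (u + v) = bar u + bar v;
  barZ : forall (r : laurent) v, bar (r *: v) = lbar r *: bar v;
  bar_m1 : bar (m 1%g) = m 1%g;
  barT : forall v x, bar (act v (T x)) = act (bar v) (T x^-1%g)^-1
}.

(* C is the element ^J C'_y.  The sum is over a finite set (a finitely supported
   sum in general); size P = deg P + 1 for P <> 0. *)
Definition is_KL_element (W : groupType) (S J : set W)
    (M : lmodType laurent) (m : W -> M) (bar : M -> M) (y : W) (C : M) : Prop :=
  bar C = C /\
  exists P : W -> {poly int},
    [/\ C = tX (- (len S y)%:Z) *:
              (\sum_(x \in [set x | dist_reps S J x /\ bruhat_le S x y])
                 at_q (P x) *: m x),
        P y = 1
      & forall x, dist_reps S J x -> bruhat_lt S x y -> P x <> 0 ->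
          ((size (P x)).-1.*2 + len S x + 1 <= len S y)%N].

(* C'_s and ^J D'_ss. *)
Definition C_simple (W : groupType) (H : unitAlgType laurent) (T : W -> H)
    (s : W) : H := tX (-1) *: (T 1%g + T s).

Definition D_word (W : groupType) (H : unitAlgType laurent) (T : W -> H)
    (M : lmodType laurent) (act : M -> H -> M) (m : W -> M)
    (ss : seq W) : M := act (m 1%g) (\prod_(s <- ss) C_simple T s).

Section Procedure.
Context (W : groupType) (S J : set W) (H : unitAlgType laurent) (T : W -> H)
  (M : lmodType laurent) (act : M -> H -> M) (m : W -> M).

(* F = \sum_(x in W^J) f_x(t) (m_x / t^l(x)), with f_x = f@_x. *)
Definition normalized_coefs (F : M) (f : {malg laurent[W]}) : Prop :=
  expansion (dist_reps S J) (fun x => tX (- (len S x)%:Z) *: m x) F f.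

(* x lies in W^J, x < y, and f_x has a nonzero term of non-negative degree. *)
Definition active (y : W) (F : M) (x : W) : Prop :=
  [/\ dist_reps S J x, bruhat_lt S x y
    & exists2 f, normalized_coefs F f &
        exists2 i : int, 0 <= i & (f@_x)@_i <> 0].

Definition stops (y : W) (F : M) : Prop := ~ exists x, active y F x.

Definition replacement (y : W) (F F' : M) : Prop :=
  exists (f : {malg laurent[W]}) (x : W) (ss' : seq W),
    [/\ normalized_coefs F f,
        active y F x,
        forall z, active y F z -> (len S z <= len S x)%N,
        reduced_word S x ss'
      & F' = F - (lnneg f@_x + lbar (lpos f@_x)) *: D_word T act m ss'].

Definition stage (y : W) (ss : seq W) : M -> Prop :=
  clos_refl_trans M (replacement y) (D_word T act m ss).

End Procedure.

(* Main.v *)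
Require Import Defs.
From HB Require Import structures.
From mathcomp Require Import all_boot all_order all_algebra finmap.
From mathcomp Require Import boolp classical_sets cardinality fsbigop monalg zify.
From Stdlib Require Import Operators_Properties.

(** Each [D_word] is bar-invariant, since every [C'_s] is, and equals
    [m_x / t^l(x)] plus terms [m_z] with [z < x] in the Bruhat order, by the
    lifting property.  Hence the bar involution is unitriangular with respect
    to length, and a bar-invariant element whose normalized coefficients all
    lie in [t^-1 Z[t^-1]] vanishes: its coefficient at an index of maximal
    length is fixed by [t |-> t^-1].  All values of [F] are bar-invariant with
    leading coefficient 1 at [y], so when the procedure stops [F - C'_y] is
    zero.  A replacement at [x] deactivates [x] and changes no other
    coefficient at lengths at least [l(x)], whence termination.

    The lifting property rests on the strong exchange condition, obtained as in
    Bourbaki from the sign cocycle [eta : W -> (W -> bool)], which the universal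
    property of the presentation provides as a homomorphism from [W] to the
    semidirect product of [W -> bool] and [W]. *)

Set Implicit Arguments.
Unset Strict Implicit.
Unset Printing Implicit Defensive.

(** * Coxeter groups *)

Section SignCocycleGroup.
Variable W : groupType.
Local Open Scope group_scope.

Definition sign_sdprod := ((W -> bool) * W)%type.

HB.instance Definition _ := gen_eqMixin sign_sdprod.
HB.instance Definition _ := gen_choiceMixin sign_sdprod.

Implicit Types a b c : sign_sdprod.

(** The second factor acts on sign functions by conjugating their argument, so the first component
    of a multiplicative map obeys a cocycle rule. *)
Definition sdmul a b : sign_sdprod :=
  (fun r => a.1 r (+) b.1 (a.2^-1 * r * a.2), a.2 * b.2).
Definition sdone : sign_sdprod := (fun=> false, 1).
Definition sdinv a : sign_sdprod := (fun r => a.1 (a.2 * r * a.2^-1), a.2^-1).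

Lemma sdmulA : associative sdmul.
Proof.
move=> a b c; congr pair; rewrite /= ?mulgA //; apply/funext=> r /=.
by rewrite addbA invgM !mulgA.
Qed.

Lemma sdmul1 : left_id sdone sdmul.
Proof.
case=> f u; congr pair; rewrite /= ?mul1g //; apply/funext=> r /=.
by rewrite invg1 mul1g mulg1.
Qed.

Lemma sdmulr1 : right_id sdone sdmul.
Proof.
case=> f u; congr pair; rewrite /= ?mulg1 //; apply/funext=> r /=.
by rewrite addbF.
Qed.

Lemma sdmulV : left_inverse sdone sdinv sdmul.
Proof.
case=> f u; congr pair; rewrite /= ?mulVg //; apply/funext=> r /=.
by rewrite invgK addbb.
Qed.

Lemma sdmulrV : right_inverse sdone sdinv sdmul.
Proof.
case=> f u; congr pair; rewrite /= ?mulgV //; apply/funext=> r /=.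
by rewrite !mulgA mulgV mul1g mulgK addbb.
Qed.

HB.instance Definition _ :=
  isGroup.Build sign_sdprod sdmulA sdmul1 sdmulr1 sdmulV sdmulrV.

End SignCocycleGroup.

Section CoxeterGroup.
Variables (W : groupType) (S : set W).
Local Open Scope group_scope.
Implicit Types (u v w x y z r s : W) (ss : seq W).

(** * Words, generators and length *)

Lemma generated_min (A G : set W) :
  is_subgroup G -> (A `<=` G)%classic -> (generated A `<=` G)%classic.
Proof. by move=> sG AG x; apply; split. Qed.

Lemma word_prod_cat ss1 ss2 :
  word_prod (ss1 ++ ss2) = word_prod ss1 * word_prod ss2.
Proof. by elim: ss1 => [|s ss1 IH] /=; rewrite ?mul1g // IH mulgA. Qed.

Lemma word_prod_rcons ss s : word_prod (rcons ss s) = word_prod ss * s.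
Proof. by rewrite -cats1 word_prod_cat /= mulg1. Qed.

Lemma word_for_cat ss1 ss2 x y :
  word_for S x ss1 -> word_for S y ss2 -> word_for S (x * y) (ss1 ++ ss2).
Proof.
move=> [h1 <-] [h2 <-]; split; last by rewrite word_prod_cat.
by move=> s; rewrite mem_cat => /orP[/h1|/h2].
Qed.

Lemma word_for_rcons ss x s :
  word_for S x ss -> S s -> word_for S (x * s) (rcons ss s).
Proof.
move=> hx Ss; rewrite -cats1; apply: word_for_cat => //; split=> [r|] /=.
  by rewrite inE => /eqP->.
by rewrite mulg1.
Qed.

Hypothesis hW : coxeter_system S.

Lemma simple_sqr s : S s -> s * s = 1.
Proof.
by case: hW => _ [m [m1 _ mS _]] Ss; have := mS _ _ Ss Ss; rewrite m1.
Qed.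

Lemma simpleV s : S s -> s^-1 = s.
Proof. by move/simple_sqr => ss1; apply: mulg1_eq. Qed.

Lemma simpleKr s x : S s -> x * s * s = x.
Proof. by move=> Ss; rewrite -mulgA simple_sqr ?mulg1. Qed.

Lemma word_for_exists w : exists ss, word_for S w ss.
Proof.
suff: (generated S `<=` [set w | exists ss, word_for S w ss])%classic.
  by apply; case: hW => -> _.
apply: generated_min => [|s Ss]; last first.
  by exists [:: s]; split=> [r|] /=; rewrite ?inE ?mulg1 // => /eqP->.
split=> [|x y [s1 h1] [s2 h2]|x [ss [h1 <-]]].
- by exists [::].
- by exists (s1 ++ s2); apply: word_for_cat.
exists (rev ss); split=> [s|]; first by rewrite mem_rev; apply: h1.
elim: ss h1 => [|s ss IH] h1 /=; first by rewrite invg1.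
rewrite rev_cons word_prod_rcons IH => [|r rs]; last by apply: h1; rewrite inE rs orbT.
by rewrite invgM (simpleV (h1 s _)) ?mem_head.
Qed.

Lemma len_is_length w : is_length S w (len S w).
Proof.
apply: (@xgetPex _ 0%N [set n | is_length S w n]%classic).
have ex : exists n, `[< exists ss, word_for S w ss /\ size ss = n >].
  by have [ss h] := word_for_exists w; exists (size ss); apply/asboolP; exists ss.
case: (ex_minnP ex) => n /asboolP hn nmin; exists n; split=> // ss hss.
by apply: nmin; apply/asboolP; exists ss.
Qed.

Lemma len_le_size w ss : word_for S w ss -> (len S w <= size ss)%N.
Proof. by have [_] := len_is_length w; apply. Qed.

Lemma reduced_word_exists w : exists ss, reduced_word S w ss.
Proof. by have [[ss []]] := len_is_length w; exists ss. Qed.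

Lemma len1 : len S 1 = 0%N.
Proof. by apply/eqP; rewrite -leqn0 (@len_le_size _ [::]). Qed.

Lemma len_mul_simple w s : S s -> (len S (w * s) <= (len S w).+1)%N.
Proof.
move=> Ss; have [ss [hss <-]] := reduced_word_exists w.
by rewrite -(size_rcons ss s); apply/len_le_size/word_for_rcons.
Qed.

Lemma len_le_mul_simple w s : S s -> (len S w <= (len S (w * s)).+1)%N.
Proof. by move=> Ss; rewrite -[w in leqLHS](simpleKr w Ss) len_mul_simple. Qed.

Lemma eqg_conj r u x : (u^-1 * r * u == x) = (r == u * x * u^-1).
Proof.
by apply/eqP/eqP=> [<-|->]; rewrite !mulgA ?mulgV ?mulVg mul1g ?mulgK ?mulgVK.
Qed.

(* In the semidirect product (W -> bool) x| W, the first component of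
   (f_s f_s')^n is the parity of the list (s s')^i s, i < 2n, of reflections;
   its period m(s,s') makes every reflection occur an even number of times. *)
Lemma sign_cocycle_exists : exists eta : W -> W -> bool,
  (forall u v r, eta (u * v) r = eta u r (+) eta v (u^-1 * r * u)) /\
  (forall s r, S s -> eta s r = (r == s)).
Proof.
have [genS [m [_ _ mS univ]]] := hW.
pose f s : sign_sdprod W := (fun r => r == s, s).
have [s s' Ss Ss'|phi [phiM phiS]] := univ _ f.
  pose c := s * s'.
  have fE n r : ((f s * f s') ^+ n).1 r
      = \big[addb/false]_(0 <= i < n.*2) (r == c ^+ i * s).
    elim: n r => [|n IH] r; first by rewrite expg0 big_geq.
    rewrite expgS /= IH doubleS big_nat_recl // big_nat_recl //= addbA.
    congr (_ (+) _ (+) _); first by rewrite mul1g.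
      by rewrite eqg_conj simpleV.
    apply/eq_bigr=> i _; rewrite eqg_conj; congr (_ == _).
    by rewrite -/c (expgS c i.+1) expgSr [in X in _ * X]/c invgM !simpleV // /c !mulgA.
  apply: injective_projections; last first.
    have -> n : ((f s * f s') ^+ n).2 = (s * s') ^+ n.
      by elim: n => [|n IH]; rewrite ?expg0 // !expgS /= IH.
    exact: mS.
  apply/funext=> r; rewrite fE -addnn (@big_cat_nat _ _ _ (m s s')) ?leq_addr //=.
  rewrite -{2}(add0n (m s s')) big_addn addnK.
  under [X in _ (+) X]eq_bigr => i _ do rewrite expgnDr mS // mulg1.
  by rewrite addbb.
(* The second component of [phi] is the identity because it is so on generators; this makes the
   first component a cocycle for conjugation by [W] itself. *)
have phi2 w : (phi w).2 = w.
  have phi1 : phi 1 = 1 by apply: (mulgI (phi 1)); rewrite -phiM !mulg1.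
  suff : (generated S `<=` [set w | (phi w).2 = w])%classic by apply; rewrite genS.
  apply: generated_min => [|s Ss] /=; last by rewrite phiS.
  split=> [|x y /= hx hy|x /= hx]; first by rewrite /= phi1.
    by rewrite phiM /= hx hy.
  have : (phi (x * x^-1)).2 = 1 by rewrite mulgV phi1.
  by rewrite phiM /= hx => e; apply: (mulgI x); rewrite e mulgV.
exists (fun w => (phi w).1); split=> [u v r|s r Ss]; last by rewrite phiS.
by rewrite phiM /= phi2.
Qed.

(** * Reflections and the strong exchange condition *)

Lemma reflection_sqr r : reflection S r -> r * r = 1.
Proof.
move=> [u [s [Ss ->]]].
by rewrite !mulgA mulgVK -(mulgA u) simple_sqr // mulg1 mulgV.
Qed.

(** The value [eta w r] decides whether [r * w] is shorter than [w]. A true value lets a letter be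
    deleted, and since [eta r r] is true, [eta] at [r] takes opposite values on [w] and [r * w], so
    one of the two is strictly shorter. *)
Lemma left_strong_exchange r w :
  reflection S r ->
  (len S (r * w) <> len S w) /\
  ((len S (r * w) < len S w)%N -> forall ss, word_for S w ss ->
    exists ss1 s ss2, ss = ss1 ++ s :: ss2 /\ r * w = word_prod (ss1 ++ ss2)).
Proof.
have [eta [etaM etaS]] := sign_cocycle_exists.
have eta1 q : eta 1 q = false.
  by have := etaM 1 1 q; rewrite invg1 mulg1 mul1g mulg1; case: (eta 1 q).
(* Along a word, [eta] adds up the indicators that the successively conjugated [q] equals the next
   letter. A true sum has a true term, and the letter there can be deleted. *)
have del ss q : (forall s, s \in ss -> S s) -> eta (word_prod ss) q ->
    exists ss1 s ss2,
      ss = ss1 ++ s :: ss2 /\ q * word_prod ss = word_prod (ss1 ++ ss2).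
  elim: ss q => [|s ss IH] q hss /=; first by rewrite eta1.
  have Ss : S s by apply: hss; rewrite mem_head.
  rewrite etaM etaS //; case: (eqVneq q s) => [-> _|_] /=.
    by exists [::], s, ss; rewrite mulgA simple_sqr ?mul1g.
  case/IH=> [p ps|ss1 [p [ss2 [-> eq]]]]; first by apply: hss; rewrite inE ps orbT.
  exists (s :: ss1), p, ss2; split=> //=; rewrite -eq.
  by rewrite !mulgA mulgV mul1g.
have lt x q : eta x q -> (len S (q * x) < len S x)%N.
  have [ss [[hss <-] <-]] := reduced_word_exists x => /(del _ _ hss).
  move=> [ss1 [s [ss2 [ess ->]]]]; rewrite ess size_cat /= addnS ltnS -size_cat.
  apply: len_le_size; split=> // p ps; apply: hss; rewrite ess.
  by move: ps; rewrite !mem_cat inE => /orP[|] ->; rewrite ?orbT.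
move=> hr; have rr := reflection_sqr hr; have [u [s [Ss er]]] := hr.
have rV : r^-1 = r by apply: mulg1_eq.
(* For [r = u s u^-1] the contributions of [u] and [u^-1] cancel, by the cocycle rule for
   [u u^-1 = 1]; only [eta s s] remains. *)
have etar : eta r r.
  have e1 : u^-1 * r * u = s by rewrite er !mulgA mulVg mul1g mulgVK.
  have e2 : (u * s)^-1 * r * (u * s) = s.
    by rewrite er invgM !mulgA mulgVK mulgVK simpleV // simple_sqr // mul1g.
  have := etaM u u^-1 r; rewrite mulgV eta1 e1.
  have -> : eta r r = eta (u * s * u^-1) r by rewrite -er.
  rewrite !etaM e1 e2 (etaS s) // eqxx.
  by do 2!case: (eta _ _).
have etaN : eta (r * w) r = ~~ eta w r.
  by rewrite etaM etar rV rr mul1g.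
have rK : r * (r * w) = w by rewrite mulgA rr mul1g.
case ew: (eta w r); split; rewrite ?ew; first by have := lt _ _ ew; lia.
- by move=> _ ss [hss ess]; have := del ss r hss; rewrite ess ew; apply.
- by have := @lt (r * w) r; rewrite etaN ew rK => /(_ isT); lia.
- by have := @lt (r * w) r; rewrite etaN ew rK => /(_ isT); lia.
Qed.

Lemma reflectionJ r x : reflection S r -> reflection S (x * r * x^-1).
Proof.
move=> [w [s [Ss ->]]]; exists (x * w), s; split=> //.
by rewrite invgM !mulgA.
Qed.

Lemma reflection_simple s : S s -> reflection S s.
Proof. by exists 1, s; rewrite invg1 mulg1 mul1g. Qed.

Lemma len_mul_reflection r w : reflection S r -> len S (w * r) <> len S w.
Proof.
move=> hr; have [] := left_strong_exchange w (reflectionJ w hr).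
by rewrite mulgVK.
Qed.

(** Right multiplication of [w] by [r] is left multiplication by the reflection [w r w^-1], to which
    the left version applies. *)
Lemma strong_exchange r w ss :
  reflection S r -> (len S (w * r) < len S w)%N -> word_for S w ss ->
  exists ss1 s ss2, ss = ss1 ++ s :: ss2 /\ w * r = word_prod (ss1 ++ ss2).
Proof.
move=> hr; have [_] := left_strong_exchange w (reflectionJ w hr).
by rewrite mulgVK => h lt hss; have [//|s1 [s [s2 h2]]] := h _ ss hss; exists s1, s, s2.
Qed.

Lemma len_mul_simpleP w s : S s ->
  len S (w * s) = (len S w).+1 \/ len S w = (len S (w * s)).+1.
Proof.
move=> Ss; have := len_mul_reflection (w := w) (reflection_simple Ss).
by have := len_mul_simple w Ss; have := len_le_mul_simple w Ss; lia.
Qed.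

(** * The Bruhat order: lifting, subwords and finite intervals *)

Lemma bruhat_le_trans : forall x y z,
  bruhat_le S x y -> bruhat_le S y z -> bruhat_le S x z.
Proof. by move=> x y z; apply: rt_trans. Qed.

Lemma bruhat_le_mul_simple x s : S s -> (len S x < len S (x * s))%N ->
  bruhat_le S x (x * s).
Proof.
move=> Ss lt; apply: rt_step; split=> //; exists s => //.
exact: reflection_simple.
Qed.

Lemma bruhat_le_len x y : bruhat_le S x y -> (len S x <= len S y)%N.
Proof.
elim=> [u v [_ /ltnW]//|u|u v w _ h1 _ h2]; first exact: leqnn.
exact: leq_trans h1 h2.
Qed.

Lemma bruhat_le_eq_len x y : bruhat_le S x y -> (len S y <= len S x)%N -> x = y.
Proof.
elim=> [u v [_ lt]|u|u v w uv h1 vw h2] //; first by rewrite leqNgt lt.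
have := bruhat_le_len uv; have := bruhat_le_len vw => l1 l2 l3.
by transitivity v; [apply: h1 | apply: h2]; lia.
Qed.

(** Write [v = u r]. If [r = s] then [u s = v], and if [u s < u] then [u s < u < v]. Otherwise [u s]
    and [v s] differ by the reflection [s r s], and strong exchange rules out that [v s] is the
    shorter one. *)
Lemma bruhat_edge_lifting u v s : S s -> bruhat_edge S u v ->
  bruhat_le S (u * s) v \/ bruhat_le S (u * s) (v * s).
Proof.
move=> Ss [[r hr ->] lt].
case: (eqVneq r s) => [->|rs]; first by left; apply: rt_refl.
have [lus|lus] := len_mul_simpleP u Ss; last first.
  left; apply: (@bruhat_le_trans _ u); last by apply: rt_step; split=> //; exists r.
  rewrite -[X in bruhat_le S _ X](simpleKr u Ss).
  by apply: bruhat_le_mul_simple; rewrite ?simpleKr // lus.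
right; have hr' : reflection S (s * r * s).
  by have := reflectionJ s hr; rewrite simpleV.
have e : u * s * (s * r * s) = u * r * s by rewrite !mulgA simpleKr.
have := len_mul_reflection (w := u * s) hr'; rewrite e => neq.
have [lt2|le2] := ltnP (len S (u * s)) (len S (u * r * s)).
  by apply: rt_step; split=> //; exists (s * r * s).
have lt2 : (len S (u * s * (s * r * s)) < len S (u * s))%N by rewrite e; lia.
have [ss [hss sz]] := reduced_word_exists u.
have [ss1 [p [ss2 [ess]]]] := strong_exchange hr' lt2 (word_for_rcons hss Ss).
(* Deleting the final [s] would give [u r s = u], that is [r = s]; deleting a letter of the reduced
   word of [u] would make [u r] shorter than [u]. *)
rewrite e; case: (lastP ss2) ess => [|ss2' q] ess eq.
  move: ess; rewrite cats1 => /rcons_inj[ess _].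
  case/eqP: rs; apply: (mulgI u); apply: (mulIg s).
  by rewrite simpleKr // eq cats0 -ess; case: hss.
move: ess; rewrite -rcons_cons -rcons_cat => /rcons_inj[ess sq].
move: eq; rewrite -rcons_cat word_prod_rcons -sq => /mulIg eq.
have : (len S (u * r) <= size (ss1 ++ ss2'))%N.
  apply: len_le_size; split=> // x xs; case: hss => hss _; apply: hss.
  by rewrite ess; move: xs; rewrite !mem_cat inE => /orP[|] ->; rewrite ?orbT.
by move: lt; rewrite -sz ess !size_cat /=; lia.
Qed.

Lemma bruhat_lifting u v s : S s -> bruhat_le S u v ->
  (len S v < len S (v * s))%N -> bruhat_le S (u * s) (v * s).
Proof.
move=> Ss /(@clos_rt_rt1n _ _ _ _) uv lt.
(* The disjunction passes along a chain of edges whatever the length of [v s]; the length hypothesis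
   turns its first case into the second. *)
suff [h|//] : bruhat_le S (u * s) v \/ bruhat_le S (u * s) (v * s).
  exact: bruhat_le_trans h (bruhat_le_mul_simple Ss lt).
elim: uv {lt} => [x|x y z xy yz]; first by right; apply: rt_refl.
have yz' : bruhat_le S y z by apply: clos_rt1n_rt.
have [h _|h [h2|h2]] := bruhat_edge_lifting Ss xy.
- by left; apply: bruhat_le_trans h yz'.
- by left; apply: bruhat_le_trans h h2.
- by right; apply: bruhat_le_trans h h2.
Qed.

(** Each descending edge deletes one letter, by strong exchange. The subword need not be reduced:
    for the finiteness of intervals it suffices that a word has finitely many subwords. *)
Lemma bruhat_le_subword x y ss : word_for S y ss -> bruhat_le S x y ->
  exists2 ss', word_for S x ss' & subseq ss' ss.
Proof.
move=> hss xy; elim: xy ss hss => {x y} [x y [[r hr ey] lt]|x|x y z _ h1 _ h2] ss hss.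
- have rr := reflection_sqr hr.
  have xr : x = y * r by rewrite ey -mulgA rr mulg1.
  move: lt; rewrite {1}xr => lt.
  have [ss1 [s [ss2 [ess eq]]]] := strong_exchange hr lt hss.
  have sub : subseq (ss1 ++ ss2) ss.
    by rewrite ess; apply: cat_subseq => //; apply: subseq_cons.
  exists (ss1 ++ ss2) => //; split; last by rewrite xr eq.
  by move=> p ps; case: hss => + _; apply; apply: mem_subseq ps.
- by exists ss.
- have [ss1 hss1 sub1] := h2 _ hss; have [ss2 hss2 sub2] := h1 _ hss1.
  by exists ss2 => //; apply: subseq_trans sub1.
Qed.

Lemma finite_bruhat_interval y : finite_set [set x | bruhat_le S x y]%classic.
Proof.
have [ss hss] := word_for_exists y.
pose f (t : (size ss).-tuple bool) := word_prod (mask t ss).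
apply: (@sub_finite_set _ _ (f @` setT)%classic); last exact/finite_image/finite_finset.
move=> x /= /(bruhat_le_subword hss)[ss' [_ <-] /subseqP[b /eqP sz ->]].
by exists (Tuple sz).
Qed.

(** For [w] in [W_J], [l(x) < l(x s) <= l(w x s) <= l(w x) + 1]. *)
Lemma dist_reps_mul_simple J x s : S s -> dist_reps S J (x * s) ->
  (len S x < len S (x * s))%N -> dist_reps S J x.
Proof.
move=> Ss hx lt w Jw; rewrite -ltnS; apply: leq_trans lt _.
by apply: leq_trans (hx w Jw) _; rewrite mulgA; apply: len_mul_simple.
Qed.

End CoxeterGroup.

Import Order.TTheory GRing.Theory Num.Theory.
Local Open Scope ring_scope.

(** * Laurent polynomials and coordinates *)

Section LaurentCoefficients.
Implicit Types (f g : laurent) (i j k : int).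

Lemma tXD i j : tX i * tX j = tX (i + j).
Proof. by rewrite [LHS]lmulUU mulr1. Qed.

Lemma mcoeff_tXM i f k : (tX i * f)@_k = f@_(k - i).
Proof.
have -> : tX i * f = laurent_mul (tX i) f by [].
rewrite [f in LHS]monalgE [f in RHS]monalgE lmul_sumr !raddf_sum /=.
apply: eq_bigr => j _; rewrite lmulUU mul1r !mcoeffU.
by congr (_ *+ (nat_of_bool _)); apply/eqP/eqP; lia.
Qed.

Lemma mcoeff_intrM (c : int) f k : (c%:~R * f)@_k = c * f@_k.
Proof. by rewrite mulrzl raddfMz -mulrzl intz. Qed.

Lemma lbar_tX i : lbar (tX i) = tX (- i).
Proof. exact: lbarU. Qed.

Lemma mcoeff_lnneg f i : (lnneg f)@_i = if 0 <= i then f@_i else 0.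
Proof.
rewrite mcoeffE; case: (boolP (i \in msupp f)) => // /mcoeff_outdom ->.
by rewrite if_same.
Qed.

Lemma mcoeff_lpos f i : (lpos f)@_i = if 0 < i then f@_i else 0.
Proof.
rewrite mcoeffE; case: (boolP (i \in msupp f)) => // /mcoeff_outdom ->.
by rewrite if_same.
Qed.

(** This is the multiplier of a replacement. Its coefficients are even in [i], so it is
    bar-invariant, and it agrees with [f] in all degrees [i >= 0]. *)
Lemma mcoeff_symmetrized f i : (lnneg f + lbar (lpos f))@_i = f@_`|i|.
Proof.
rewrite mcoeffD lbarE mcoeff_lnneg mcoeff_lpos oppr_gt0.
by case: (leP 0 i) => hi; [rewrite addr0 ger0_norm | rewrite add0r ltr0_norm].
Qed.

Lemma lbar_symmetrized f :
  lbar (lnneg f + lbar (lpos f)) = lnneg f + lbar (lpos f).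
Proof. by apply/malgP => i; rewrite lbarE !mcoeff_symmetrized normrN. Qed.

Lemma mcoeff_at_q (P : {poly int}) i :
  ((size P).-1.*2%:Z < i) -> (at_q P)@_i = 0.
Proof.
move=> lti; rewrite /at_q (@horner_coef_wide _ (size P)) ?size_poly //.
rewrite raddf_sum big1 //= => j _.
rewrite coef_map /= mcoeff_intrM.
have -> n : tX 2 ^+ n = tX n.*2%:Z.
  elim: n => [|n IH]; first by rewrite expr0.
  by rewrite exprS IH tXD; congr tX; lia.
have ltj := ltn_ord j; rewrite mcoeffU; case: eqP => [e|]; rewrite ?mulr0 //.
move: lti; rewrite -e ltz_nat ltn_double ltnNge -ltnS => /negP[].
exact: leq_trans ltj (leqSpred _).
Qed.

Lemma at_q1 : at_q 1 = 1.
Proof. by rewrite /at_q rmorph1 hornerC. Qed.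

End LaurentCoefficients.

(** * Coordinates with respect to a basis of a module *)

Section Coordinates.
Variables (R : comNzRingType) (M : lmodType R) (I : choiceType).
Variables (D : set I) (b : I -> M).
Implicit Types (c d : {malg R[I]}) (u v : M) (x : I).

Lemma expansion_le (X : {fset I}) v c : (msupp c `<=` X)%fset ->
  (forall x, x \in msupp c -> D x) -> v = \sum_(x <- X) c@_x *: b x ->
  expansion D b v c.
Proof.
move=> cX Dc ->; split=> //; apply/esym/big_fset_incl => // x _ /mcoeff_outdom ->.
by rewrite scale0r.
Qed.

Lemma expansion_widen (X : {fset I}) v c : (msupp c `<=` X)%fset ->
  expansion D b v c -> v = \sum_(x <- X) c@_x *: b x.
Proof.
move=> cX [_ ->]; apply/big_fset_incl => // x _ /mcoeff_outdom ->.
by rewrite scale0r.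
Qed.

Lemma expansionP (a : R) u v c d : expansion D b u c -> expansion D b v d ->
  expansion D b (a *: u + v) (a *: c + d).
Proof.
move=> hu hv.
have sub : (msupp (a *: c + d) `<=` msupp c `|` msupp d)%fset.
  by apply: fsubset_trans (msuppD_le _ _) _; apply/fsetSU/msuppZ_le.
apply: (expansion_le sub) => [x /(fsubsetP sub)|].
  by rewrite inE => /orP[]; [case: hu => + _|case: hv => + _]; apply.
rewrite (expansion_widen (fsubsetUl _ (msupp d)) hu).
rewrite (expansion_widen (fsubsetUr (msupp c) _) hv).
rewrite scaler_sumr -big_split; apply: eq_bigr => x _ /=.
by rewrite mcoeffD mcoeffZ scalerDl scalerA.
Qed.

(** Coefficients are divided by the units [e x]. This serves to pass from [m_x] to
    [m_x / t^l(x)]. *)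
Lemma is_basis_scale (e e' : I -> R) : (forall x, e x * e' x = 1) ->
  is_basis D b -> is_basis D (fun x => e x *: b x).
Proof.
move=> ee' hb v; have [c [hc cuniq]] := hb v.
pose d := [malg x in msupp c => c@_x * e' x].
have dE x : d@_x = c@_x * e' x.
  by rewrite mcoeffE; case: ifPn => // /mcoeff_outdom ->; rewrite mul0r.
have dc : (msupp d `<=` msupp c)%fset.
  apply/fsubsetP=> x; rewrite -!mcoeff_neq0 dE; apply: contraNneq => ->.
  by rewrite mul0r.
exists d; split=> [|d' [D' hd']].
  split=> [x /(fsubsetP dc)|]; first by case: hc => + _; apply.
  have -> : \sum_(x <- msupp d) d@_x *: (e x *: b x) =
            \sum_(x <- msupp c) d@_x *: (e x *: b x).
    by apply/big_fset_incl => // x _ /mcoeff_outdom ->; rewrite scale0r.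
  case: hc => _ ->; apply: eq_bigr => x _.
  by rewrite scalerA dE -mulrA (mulrC (e' x)) ee' mulr1.
pose c' := [malg x in msupp d' => d'@_x * e x].
have c'E x : c'@_x = d'@_x * e x.
  by rewrite mcoeffE; case: ifPn => // /mcoeff_outdom ->; rewrite mul0r.
have cd' : (msupp c' `<=` msupp d')%fset.
  apply/fsubsetP=> x; rewrite -!mcoeff_neq0 c'E; apply: contraNneq => ->.
  by rewrite mul0r.
have cc' : c = c'.
  apply: cuniq; apply: (expansion_le cd') => [x /(fsubsetP cd')/D' //|].
  by rewrite [LHS]hd'; apply: eq_bigr => x _; rewrite c'E scalerA.
by apply/malgP => x; rewrite dE cc' c'E -mulrA ee' mulr1.
Qed.

Hypothesis hb : is_basis D b.

Definition coords v : {malg R[I]} := sval (cid (hb v)).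
Definition coord v x : R := (coords v)@_x.

Lemma coordsP v : expansion D b v (coords v).
Proof. by rewrite /coords; case: (cid _) => c []. Qed.

Lemma coords_uniq v c : expansion D b v c -> c = coords v.
Proof. by move=> hc; rewrite /coords; case: (cid _) => d [_ du] /=; apply/esym/du. Qed.

Lemma coord_lin (a : R) u v x : coord (a *: u + v) x = a * coord u x + coord v x.
Proof.
rewrite /coord -(coords_uniq (expansionP a (coordsP u) (coordsP v))).
by rewrite mcoeffD mcoeffZ.
Qed.

Lemma coord0 x : coord 0 x = 0.
Proof.
have := coord_lin (-1) 0 0 x; rewrite scaler0 addr0.
by rewrite mulN1r addNr.
Qed.

Lemma coordD u v x : coord (u + v) x = coord u x + coord v x.
Proof. by have := coord_lin 1 u v x; rewrite scale1r mul1r. Qed.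

Lemma coordZ (a : R) u x : coord (a *: u) x = a * coord u x.
Proof. by have := coord_lin a u 0 x; rewrite coord0 !addr0. Qed.

Lemma coordB u v x : coord (u - v) x = coord u x - coord v x.
Proof. by rewrite -scaleN1r coordD coordZ mulN1r. Qed.

Lemma coord_sum (K : Type) (r : seq K) (P : pred K) (F : K -> M) x :
  coord (\sum_(k <- r | P k) F k) x = \sum_(k <- r | P k) coord (F k) x.
Proof. exact: (big_morph (coord^~ x) (fun u v => coordD u v x) (coord0 x)). Qed.

Lemma coord_basis x z : D x -> coord (b x) z = (x == z)%:R.
Proof.
move=> Dx; rewrite /coord -(@coords_uniq _ << 1 *g x >>) ?mcoeffU //.
apply: (@expansion_le [fset x]%fset) => [|y|]; first exact: msuppU_le.
  by move/(fsubsetP msuppU_le); rewrite inE => /eqP->.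
by rewrite big_seq_fset1 mcoeffUU scale1r.
Qed.

Lemma coord_expand v : v = \sum_(x <- msupp (coords v)) coord v x *: b x.
Proof. by case: (coordsP v). Qed.

Lemma coord_dom v x : coord v x <> 0 -> D x.
Proof.
by move/eqP; rewrite mcoeff_neq0; case: (coordsP v) => + _; apply.
Qed.

Lemma coord_inj u v : coord u =1 coord v -> u = v.
Proof.
move=> uv; rewrite (coord_expand u) (coord_expand v).
have -> : coords u = coords v by apply/malgP=> x; apply: uv.
by apply: eq_bigr => x _; rewrite uv.
Qed.

(** Triangularity, with respect to length or to the Bruhat order, is expressed through the choice of
    [P]. *)
Definition supported (P : I -> Prop) v := forall x, coord v x <> 0 -> P x.

Lemma supported_sub (P Q : I -> Prop) v :
  (forall x, P x -> Q x) -> supported P v -> supported Q v.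
Proof. by move=> PQ hv x /hv/PQ. Qed.

Lemma supported0 P : supported P 0.
Proof. by move=> x; rewrite coord0. Qed.

Lemma supportedZ P (a : R) v : supported P v -> supported P (a *: v).
Proof.
by move=> hv x; rewrite coordZ => ax; apply: hv => v0; apply: ax; rewrite v0 mulr0.
Qed.

Lemma supportedD P u v : supported P u -> supported P v -> supported P (u + v).
Proof.
move=> hu hv x; rewrite coordD => uv.
have [u0|/eqP u0] := eqVneq (coord u x) 0; last exact: hu.
by apply: hv => v0; apply: uv; rewrite u0 v0 addr0.
Qed.

Lemma supportedB P u v : supported P u -> supported P v -> supported P (u - v).
Proof. by move=> hu hv; rewrite -scaleN1r; apply: supportedD hu _; apply: supportedZ. Qed.

Lemma supported_basis (P : I -> Prop) x : D x -> P x -> supported P (b x).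
Proof. by move=> Dx Px z; rewrite coord_basis //; case: eqP => // <-. Qed.

Lemma supported_sum (K : eqType) (r : seq K) P (F : K -> M) :
  (forall k, k \in r -> supported P (F k)) -> supported P (\sum_(k <- r) F k).
Proof.
move=> h; rewrite big_seq; elim/big_rec: _ => [|k v kr hv]; first exact: supported0.
by apply: supportedD hv; apply: h.
Qed.

Lemma supported_coord0 P v x : supported P v -> ~ P x -> coord v x = 0.
Proof. by move=> hv Px; apply: contra_notP Px => /hv. Qed.

End Coordinates.

(** * Maximal elements and a termination criterion *)

Lemma exists_argmax (T : eqType) (f : T -> nat) (P : T -> Prop) (l : seq T) :
  (forall x, P x -> x \in l) -> (exists x, P x) ->
  exists2 x, P x & forall z, P z -> (f z <= f x)%N.
Proof.
move=> Pl [x0 Px0].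
pose Q n := `[< exists2 x, P x & f x = n >].
have exQ : exists n, Q n by exists (f x0); apply/asboolP; exists x0.
have bound n : Q n -> (n <= \max_(x <- l) f x)%N.
  by move/asboolP=> [x Px <-]; apply: leq_bigmax_seq => //; apply: Pl.
case: (ex_maxnP exQ bound) => n /asboolP[x Px <-] xmax.
by exists x => // z Pz; apply: xmax; apply/asboolP; exists z.
Qed.

(* Lexicographic descent on (maximal level of an active index, number of active
   indices at that level). *)
Lemma Acc_by_levels (X : Type) (I : eqType) (step : X -> X -> Prop)
    (act : X -> I -> Prop) (lev : I -> nat) :
  (forall F, exists l : seq I, forall z, act F z -> z \in l) ->
  (forall F F', step F F' -> exists x,
     [/\ act F x, forall z, act F z -> (lev z <= lev x)%N
       & forall z, act F' z -> (lev x <= lev z)%N -> z <> x /\ act F z]) ->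
  forall F, Acc (fun F' F => step F F') F.
Proof.
move=> fin stepP.
(* Outer induction on a strict bound for the levels of the active indices. *)
have key n F : (forall z, act F z -> (lev z < n)%N) -> Acc (fun F' F => step F F') F.
  elim: n F => [|n IHn] F lt.
    by constructor=> F' /stepP[x [/lt]].
  have [l Fl] := fin F.
  have : forall z, act F z -> lev z = n -> z \in l by move=> z /Fl.
  (* Inner induction on the size of a list containing the active indices of the top level [n]. *)
  move: {2}(size l) (leqnn (size l)) => k; elim: k l F lt {Fl} => [|k IHk] l F lt szl Fl.
    apply: IHn => z Fz; have := lt z Fz; rewrite ltnS leq_eqVlt => /orP[/eqP e|//].
    by have := Fl z Fz e; case: (l) szl.
  constructor=> F' FF'; have [x [Fx xmax F'z]] := stepP _ _ FF'.
  have := lt x Fx; rewrite ltnS leq_eqVlt => /orP[/eqP ex|ltx]; last first.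
    have accF : Acc (fun F' F => step F F') F.
      by apply: IHn => z /xmax h; apply: leq_ltn_trans ltx.
    exact: (Acc_inv accF).
  have xl := Fl x Fx ex.
  (* Indices of level [n] active in [F'] were active in [F] and differ from [x], so [x] can leave
     the list. *)
  apply: (IHk (rem x l)) => [z F'z1||z F'z1 ez].
  - case: (ltnP (lev z) (lev x)) => [h|h]; first by rewrite -ex ltnS ltnW.
    by have [_ /lt] := F'z z F'z1 h.
  - by rewrite size_rem //; case: (size l) szl.
  - have [|zx Fz] := F'z z F'z1; first by rewrite ex ez.
    have := Fl z Fz ez; rewrite (perm_mem (perm_to_rem xl)) inE.
    by case/orP=> // /eqP.
move=> F; have [l Fl] := fin F.
apply: (key (\max_(x <- l) lev x).+1) => z /Fl zl.
by rewrite ltnS; apply: leq_bigmax_seq.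
Qed.

(** * The parabolic module and the procedure *)

Section ParabolicModule.
Variables (W : groupType) (S J : set W) (H : unitAlgType laurent) (T : W -> H).
Variables (M : lmodType laurent) (act : M -> H -> M) (m : W -> M) (bar : M -> M).
Hypotheses (hWS : coxeter_system S) (hH : hecke_algebra S T).
Hypotheses (hM : parabolic_module S J T act m) (hbar : bar_involution T act m bar).
Implicit Types (x y z w s : W) (ss : seq W) (u v F : M).

Local Notation D := (dist_reps S J).
Local Notation l := (len S).
Local Notation nm := (fun x : W => tX (- (len S x)%:Z) *: m x).

Lemma normalized_basis : is_basis D nm.
Proof.
apply: (is_basis_scale (e' := fun x => tX (l x))) (pmod_basis hM) => x.
by rewrite tXD addNr.
Qed.

Local Notation co := (coord normalized_basis).
Local Notation supp := (supported normalized_basis).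
Local Notation Cs := (C_simple T).
Let rM := pmod_right hM.

Lemma normalized_coefsE F f :
  normalized_coefs S J m F f -> forall x, f@_x = co F x.
Proof. by move/(coords_uniq normalized_basis) ->. Qed.

Lemma normalized_coefs_coords F : normalized_coefs S J m F (coords normalized_basis F).
Proof. exact: coordsP. Qed.

Lemma activeP y F x : active S J m y F x <->
  [/\ D x, bruhat_lt S x y & exists2 i : int, 0 <= i & (co F x)@_i <> 0].
Proof.
split=> [[Dx xy [f hf [i i0 fi]]]|[Dx xy [i i0 fi]]]; split=> //.
  by exists i => //; rewrite -(normalized_coefsE hf).
exists (coords normalized_basis F); first exact: normalized_coefs_coords.
by exists i.
Qed.

(** * The action of [C'_s] on the normalized basis and the leading term of [D_word] *)

Lemma act_C u s : act u (Cs s) = tX (-1) *: (u + act u (T s)).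
Proof. by rewrite /C_simple (actZr rM) (actDr rM) (hecke_one hH) (act1 rM). Qed.

Lemma act_C_up z s : D z -> S s -> (l z < l (z * s)%g)%N -> D (z * s)%g ->
  act (nm z) (Cs s) = nm (z * s)%g + tX (-1) *: nm z.
Proof.
move=> Dz Ss lt Dzs; rewrite act_C (actZl rM) (pmod_up hM) // addrC scalerDr.
congr (_ + _); rewrite scalerA tXD; congr (tX _ *: _).
by have := len_mul_simpleP hWS z Ss; lia.
Qed.

Lemma act_C_stay z s : D z -> S s -> (l z < l (z * s)%g)%N -> ~ D (z * s)%g ->
  act (nm z) (Cs s) = (tX (-1) + tX 1) *: nm z.
Proof.
move=> Dz Ss lt Dzs; rewrite act_C (actZl rM) (pmod_stay hM) // scalerDr scalerDl.
congr (_ + _); rewrite !scalerA !tXD; congr (tX _ *: _).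
by lia.
Qed.

Lemma act_C_down z s : D z -> S s -> (l (z * s)%g < l z)%N ->
  act (nm z) (Cs s) = nm (z * s)%g + tX 1 *: nm z.
Proof.
move=> Dz Ss lt; rewrite act_C (actZl rM) (pmod_down hM) //.
rewrite scalerBl scale1r -scalerDr addrCA [m z + _]addrC subrK.
rewrite !scalerDr !scalerA !tXD.
by have := len_mul_simpleP hWS z Ss => h; congr (tX _ *: _ + tX _ *: _); lia.
Qed.

Lemma act_sum (K : Type) (r : seq K) (F : K -> M) h :
  act (\sum_(k <- r) F k) h = \sum_(k <- r) act (F k) h.
Proof.
apply: (big_morph (act^~ h)) => [u v|]; first exact: (actDl rM).
by have := actZl rM 0 0 h; rewrite !scale0r.
Qed.

(** In each of the three cases of the action, [m_z C'_s] involves no index other than [z] and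
    [z s]. *)
Lemma supported_act_C (P Q : W -> Prop) u s : S s -> supp P u ->
  (forall z, D z -> P z -> Q z /\ Q (z * s)%g) -> supp Q (act u (Cs s)).
Proof.
move=> Ss Pu PQ; rewrite (coord_expand normalized_basis u) act_sum.
apply: supported_sum => z; rewrite -mcoeff_neq0 => /eqP uz.
have Dz : D z by apply: coord_dom uz.
have [Qz Qzs] := PQ z Dz (Pu z uz).
rewrite (actZl rM); apply: supportedZ.
have sz a : supp Q (a *: nm z) by apply: supportedZ; apply: supported_basis.
have [lzs|lzs] := len_mul_simpleP hWS z Ss.
  have ltz : (l z < l (z * s)%g)%N by rewrite lzs.
  have [Dzs|Dzs] := pselect (D (z * s)%g); last by rewrite act_C_stay.
  by rewrite act_C_up //; apply: supportedD; first apply: supported_basis.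
have ltz : (l (z * s)%g < l z)%N by rewrite lzs.
rewrite act_C_down //; apply: supportedD => //; apply: supported_basis => //.
(* [z = (z s) s] lies in [W^J] and is longer than [z s]. *)
by apply: (dist_reps_mul_simple hWS Ss); rewrite (simpleKr hWS).
Qed.

Lemma D_word_rcons ss s : D_word T act m (rcons ss s) = act (D_word T act m ss) (Cs s).
Proof. by rewrite /D_word big_rcons /= (actM rM). Qed.

Lemma D_word_nil : D_word T act m [::] = m 1%g.
Proof. by rewrite /D_word big_nil (act1 rM). Qed.

(** Induction on the last letter, with [x = x' s]: the leading term at [x'] yields [x] with
    coefficient 1 and the smaller [x'], while lifting keeps [z s] below [x] for every [z < x']. *)
Lemma D_word_lead ss x : reduced_word S x ss -> D x ->
  exists2 u, supp (bruhat_lt S ^~ x) u & D_word T act m ss = nm x + u.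
Proof.
elim/last_ind: ss x => [|ss s IH] x.
  move=> [[_ <-] _] _; exists 0; first exact: supported0.
  by rewrite D_word_nil addr0 /= (len1 hWS) oppr0 [tX 0]/(1 : laurent) scale1r.
move=> [[hss <-] sz]; rewrite word_prod_rcons in sz *.
set x' := word_prod ss in sz *.
have Ss : S s by apply: hss; rewrite mem_rcons mem_head.
have hx' : word_for S x' ss by split=> // r rs; apply: hss; rewrite mem_rcons inE rs orbT.
have lx' := len_le_size hWS hx'; have lx := len_mul_simple hWS x' Ss.
rewrite size_rcons in sz.
have ex' : size ss = l x' by lia.
have ltx : (l x' < l (x' * s)%g)%N by lia.
move=> Dx; have Dx' := dist_reps_mul_simple hWS Ss Dx ltx.
have [||u su uE] := IH x'; [by split| by []|].
have lex : bruhat_le S x' (x' * s)%g by apply: bruhat_le_mul_simple.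
rewrite D_word_rcons uE.
exists (tX (-1) *: nm x' + act u (Cs s)); last first.
  by rewrite (actDl rM) act_C_up // addrA.
apply: supportedD.
  apply: supportedZ; apply: supported_basis => //; split=> // e.
  by rewrite -e ltnn in ltx.
apply: supported_act_C su _ => // z Dz [zx zx']; split; split.
- exact: bruhat_le_trans lex.
- by move=> ez; have := bruhat_le_len zx; rewrite ez leqNgt ltx.
- exact: bruhat_lifting.
- by move/mulIg.
Qed.

(** * The bar involution and its unitriangularity *)

Lemma simple_inv s : S s -> (T s)^-1 = tX (-2) *: T s + (tX (-2) - 1) *: 1.
Proof.
move=> Ss; set U := RHS.
have sq := hecke_sqr hH Ss; rewrite (hecke_one hH) in sq.
have e : tX (-2) *: ((tX 2 - 1) *: T s + tX 2 *: 1) + (tX (-2) - 1) *: T s = 1 :> H.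
  have t0 : tX (-2) * tX 2 = 1 by rewrite tXD addNr.
  rewrite scalerDr !scalerA mulrBr t0 mulr1 scale1r addrAC -scalerDl.
  by rewrite addrA subrK subrr scale0r add0r.
(* A two-sided inverse makes [T s] a unit, so that [^-1] is a genuine inverse rather than a default
   value. *)
have TU : T s * U = 1 by rewrite mulrDr -!scalerAr sq mulr1.
have UT : U * T s = 1 by rewrite mulrDl -!scalerAl sq mul1r.
have Tu : T s \is a GRing.unit by apply/unitrP; exists U.
by rewrite -[LHS]mulr1 -TU mulKr.
Qed.

(** [C'_s] is bar-invariant: inverting [t] and [T s] in [t^-1 (1 + T s)] gives
    [t (q^-1 T s + q^-1)], the same element. *)
Lemma bar_act_C u s : S s -> bar (act u (Cs s)) = act (bar u) (Cs s).
Proof.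
move=> Ss; rewrite !act_C (barZ hbar) (barD hbar) (barT hbar) (simpleV hWS) //.
rewrite simple_inv // (actDr rM) !(actZr rM) (act1 rM) lbar_tX opprK.
rewrite scalerBl scale1r addrCA [bar u + (_ - _)]addrC subrK -scalerDr scalerA tXD.
by rewrite [act _ _ + _]addrC.
Qed.

Lemma bar_D_word ss : (forall s, s \in ss -> S s) ->
  bar (D_word T act m ss) = D_word T act m ss.
Proof.
elim/last_ind: ss => [|ss s IH] hss; first by rewrite D_word_nil (bar_m1 hbar).
rewrite D_word_rcons bar_act_C; last by apply: hss; rewrite mem_rcons mem_head.
by rewrite IH // => r rs; apply: hss; rewrite mem_rcons inE rs orbT.
Qed.

Lemma bar0 : bar 0 = 0.
Proof.
have lbar0 : lbar 0 = 0 by apply/malgP=> i; rewrite lbarE !mcoeff0.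
by have := barZ hbar 0 0; rewrite lbar0 !scale0r.
Qed.

Lemma barB u v : bar (u - v) = bar u - bar v.
Proof.
rewrite -scaleN1r (barD hbar) (barZ hbar).
by rewrite (_ : lbar (-1) = -1) ?scaleN1r // rmorphN1.
Qed.

Lemma bar_expand u :
  bar u = \sum_(x <- msupp (coords normalized_basis u)) lbar (co u x) *: bar (nm x).
Proof.
rewrite {1}(coord_expand normalized_basis u) (big_morph bar (barD hbar) bar0).
by apply: eq_bigr => x _; apply: (barZ hbar).
Qed.

(** Unitriangularity is assumed only at lengths below [n], so that the lemma can be applied inside
    the induction proving [bar_unitriangular]. *)
Lemma supported_bar n u :
  (forall x, D x -> (l x < n)%N -> supp (fun z => (l z < l x)%N) (bar (nm x) - nm x)) ->
  supp (fun z => (l z < n)%N) u -> supp (fun z => (l z < n)%N) (bar u).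
Proof.
move=> tri su; rewrite bar_expand; apply: supported_sum => x.
rewrite -mcoeff_neq0 => /eqP ux; have Dx : D x by apply: coord_dom ux.
have lx := su x ux; apply: supportedZ.
rewrite -(subrK (nm x) (bar (nm x))); apply: supportedD.
  by apply: supported_sub (tri x Dx lx) => z /ltn_trans; apply.
exact: supported_basis.
Qed.

Lemma bar_unitriangular x : D x ->
  supp (fun z => (l z < l x)%N) (bar (nm x) - nm x).
Proof.
have [n] := ubnP (l x); elim: n x => // n IH x ltx Dx.
have [ss hss] := reduced_word_exists hWS x.
have [u su eD] := D_word_lead hss Dx.
have {}su : supp (fun z => (l z < l x)%N) u.
  apply: supported_sub su => z [zx neq]; rewrite ltnNge.
  by apply/negP => le; apply: neq; apply: bruhat_le_eq_len le.
(* As [D_word] is bar-invariant, the difference becomes [u - bar u], and induction controls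
   [bar u]. *)
have -> : nm x = D_word T act m ss - u by rewrite eD addrK.
rewrite barB bar_D_word; last by case: hss => [[]].
rewrite opprB addrC addrA subrK; apply: supportedB => //.
by apply: supported_bar su => z Dz lz; apply: IH => //; lia.
Qed.

Lemma bar_invariant_eq0 F : bar F = F ->
  (forall x (i : int), 0 <= i -> (co F x)@_i = 0) -> F = 0.
Proof.
move=> barF neg; apply: (coord_inj (hb := normalized_basis)) => x0; rewrite coord0.
apply: contrapT => nz0.
have [x nz xmax] : exists2 x, co F x <> 0 & forall z, co F z <> 0 -> (l z <= l x)%N.
  apply: (@exists_argmax _ l _ (msupp (coords normalized_basis F))); last by exists x0.
  by move=> x /eqP; rewrite mcoeff_neq0.
have Dx : D x by apply: coord_dom nz.
apply: (nz); have sym : co F x = lbar (co F x).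
  rewrite -[in LHS]barF bar_expand coord_sum.
  have xF : x \in msupp (coords normalized_basis F) by rewrite -mcoeff_neq0; apply/eqP.
  rewrite (bigD1_seq x) ?fset_uniq //= coordZ.
  (* By unitriangularity and the maximality of [l x], only the term at [x] reaches the coordinate at
     [x] of [bar F]. *)
  have lead z : D z -> (l z <= l x)%N -> co (bar (nm z)) x = (z == x)%:R.
    move=> Dz le; rewrite -(subrK (nm z) (bar (nm z))) coordD coord_basis //.
    rewrite (supported_coord0 (bar_unitriangular Dz)) ?add0r //.
    by rewrite ltnNge le.
  rewrite lead // eqxx mulr1 big_seq_cond big1 ?addr0 // => z /andP[].
  rewrite -mcoeff_neq0 => /eqP Fz zx; rewrite coordZ lead ?(negbTE zx) ?mulr0 //.
    exact: coord_dom Fz.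
  exact: xmax.
(* By symmetry, a coefficient in negative degree equals one in positive degree, which vanishes by
   [neg]. *)
apply/malgP => i; rewrite mcoeff0; have [/neg//|lt0] := leP 0 i.
by rewrite sym lbarE neg //; lia.
Qed.

(** The normalized coefficient at [x <= y] is [t^(l x - l y) P_x(q)], and for [x < y] the degree
    bound on [P_x] leaves only negative powers of [t]. *)
Lemma KL_coord y C z : is_KL_element S J m bar y C -> D y -> 
  [/\ co C y = 1, supp (bruhat_le S ^~ y) C
    & bruhat_lt S z y -> forall i : int, 0 <= i -> (co C z)@_i = 0].
Proof.
move=> [_ [P [eC Py degP]]] Dy.
set A := [set x | D x /\ bruhat_le S x y]%classic in eC.
have finA : finite_set A.
  by apply: sub_finite_set (finite_bruhat_interval hWS y) => x [].
have coC x : co C x = if x \in fset_set A then tX ((l x)%:Z - (l y)%:Z) * at_q (P x) else 0.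
  rewrite eC fsbig_finite //= coordZ coord_sum.
  rewrite (eq_big_seq (fun w => (w == x)%:R * (tX (l w) * at_q (P w)))); last first.
    move=> w; rewrite in_fset_set // inE => -[Dw _].
    have -> : m w = tX (l w) *: nm w by rewrite scalerA tXD subrr [tX 0]/(1 : laurent) scale1r.
    by rewrite scalerA coordZ coord_basis // mulrC [at_q _ * _]mulrC.
  case: ifPn => xA.
    rewrite (bigD1_seq x) ?fset_uniq //= eqxx mul1r big1 ?addr0.
      by rewrite mulrA tXD addrC.
    by move=> w /negbTE->; rewrite mul0r.
  rewrite big_seq big1 ?mulr0 // => w wA; case: eqP => [e|]; last by rewrite mul0r.
  by rewrite -e wA in xA.
have AP x : reflect (A x) (x \in fset_set A).
  by rewrite in_fset_set //; apply: (iffP idP); rewrite inE.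
split.
- rewrite coC; case: AP => [_|[]]; last by split=> //; apply: rt_refl.
  by rewrite Py at_q1 mulr1 subrr.
- by move=> x; rewrite coC; case: AP => // -[].
move=> zy i i0; rewrite coC; case: AP => [[Dz _]|_]; last by rewrite mcoeff0.
(* The degree bound concerns nonzero polynomials, so [P z = 0] is treated apart. *)
rewrite mcoeff_tXM; case: (pselect (P z = 0)) => [->|/(degP z Dz zy) deg].
  by rewrite /at_q rmorph0 horner0 mcoeff0.
by rewrite mcoeff_at_q //; lia.
Qed.

(** * Replacements, termination and the invariants of a stage *)

Lemma replacementP y F F' : replacement S J T act m y F F' ->
  exists x u, let g := lnneg (co F x) + lbar (lpos (co F x)) in
  [/\ active S J m y F x,
      forall z, active S J m y F z -> (l z <= l x)%N,
      supp (bruhat_lt S ^~ x) u,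
      bar (nm x + u) = nm x + u
    & F' = F - g *: (nm x + u)].
Proof.
move=> [f [x [ss [hf Fx xmax hss ->]]]].
have Dx : D x by case: Fx.
have [u su eD] := D_word_lead hss Dx.
exists x, u; split=> //; last by rewrite -(normalized_coefsE hf) eD.
by rewrite -eD bar_D_word //; case: hss => [[]].
Qed.

Lemma bruhat_lt_len x y : bruhat_lt S x y -> (l x < l y)%N.
Proof.
by move=> [xy neq]; rewrite ltnNge; apply/negP => /(bruhat_le_eq_len xy).
Qed.

Lemma replacement_active y F F' : replacement S J T act m y F F' -> exists x,
  [/\ active S J m y F x, forall z, active S J m y F z -> (l z <= l x)%N
    & forall z, active S J m y F' z -> (l x <= l z)%N -> z <> x /\ active S J m y F z].
Proof.
move=> /replacementP[x [u [Fx xmax su _ ->]]]; exists x; split=> // z.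
have Dx : D x by case: Fx.
move=> /activeP[Dz zy [i i0 nz]] le; move: nz; rewrite coordB coordZ coordD coord_basis //.
(* The remainder [u] lives at lengths below [l x], so among the indices [z] considered only [x] can
   change its coefficient. *)
rewrite (supported_coord0 su) ?addr0; last by move/bruhat_lt_len; rewrite ltnNge le.
case: eqP => [<-|neq]; last first.
  rewrite mulr0 subr0 => nz; split; first by move=> e; apply: neq.
  by apply/activeP; split=> //; exists i.
(* At [x] the new coefficient vanishes in every degree [i >= 0], against [nz]. *)
by rewrite mulr1 mcoeffB mcoeff_symmetrized ger0_norm // subrr.
Qed.

(** Active indices lie in the finite support of [F], so the level criterion applies from any
    starting value. *)
Lemma replacement_Acc y F : Acc (fun F' F => replacement S J T act m y F F') F.
Proof.
apply: (Acc_by_levels (act := active S J m y) (lev := l)) => [{}F|{}F F'].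
  exists (msupp (coords normalized_basis F)) => z /activeP[_ _ [i _ nz]].
  by rewrite -mcoeff_neq0; apply/eqP => z0; apply: nz; rewrite /coord z0 mcoeff0.
exact: replacement_active.
Qed.

(** These properties are common to all stages and to [C'_y]; the missing negativity of the
    coefficients below [y] is what stopping supplies. *)
Definition stage_invariant y F : Prop :=
  [/\ bar F = F, co F y = 1 & supp (bruhat_le S ^~ y) F].

Lemma stage_invariantP y ss F : D y -> reduced_word S y ss ->
  stage S J T act m y ss F -> stage_invariant y F.
Proof.
move=> Dy hss.
have inv0 : stage_invariant y (D_word T act m ss).
  have [u su eD] := D_word_lead hss Dy; split.
  - by apply: bar_D_word; case: hss => [[]].
  - rewrite eD coordD coord_basis // eqxx (supported_coord0 su) ?addr0 //.
    by move/bruhat_lt_len; rewrite ltnn.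
  - rewrite eD; apply: supportedD; last by apply: supported_sub su => z [].
    by apply: supported_basis => //; apply: rt_refl.
move=> st; move: st inv0; rewrite /stage.
elim=> {}F => [F' /replacementP[x [u [Fx _ su bu ->]]]|//|F' F'' _ h1 _ h2 /h1/h2 //].
have [Dx xy _] := Fx.
have sxu : supp (bruhat_le S ^~ x) (nm x + u).
  apply: supportedD; last by apply: supported_sub su => z [].
  by apply: supported_basis => //; apply: rt_refl.
move=> [bF Fy sF]; split.
- by rewrite barB (barZ hbar) bF bu lbar_symmetrized.
(* What is subtracted is supported below [x < y], so the coefficient at [y] is untouched. *)
- rewrite coordB coordZ (supported_coord0 sxu) ?mulr0 ?subr0 //.
  by move/bruhat_le_len; rewrite leqNgt (bruhat_lt_len xy).
- apply: supportedB => //; apply: supportedZ; apply: supported_sub sxu => z zx.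
  by apply: bruhat_le_trans zx _; case: xy.
Qed.

Lemma stops_KL y F C : D y -> is_KL_element S J m bar y C ->
  stage_invariant y F -> stops S J m y F -> F = C.
Proof.
move=> Dy hC [bF Fy sF] stop; apply/eqP; rewrite -subr_eq0; apply/eqP.
have [bC _] := hC.
apply: bar_invariant_eq0 => [|x i i0]; first by rewrite barB bF bC.
have [Cy sC Cneg] := KL_coord x hC Dy.
rewrite coordB; case: (eqVneq x y) => [->|/eqP xy]; first by rewrite Fy Cy subrr mcoeff0.
have [xley|nle] := pselect (bruhat_le S x y); last first.
  by rewrite (supported_coord0 sF) // (supported_coord0 sC) // subrr mcoeff0.
(* Below [y], a term of non-negative degree in the difference comes from [F] and would make [x]
   active. *)
rewrite mcoeffB Cneg // subr0; apply: contrapT => nz; apply: stop; exists x.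
apply/activeP; split=> //; last by exists i.
by apply: (coord_dom (hb := normalized_basis) (v := F)) => F0; apply: nz; rewrite F0 mcoeff0.
Qed.

Lemma KL_inactive y C x : D y -> is_KL_element S J m bar y C ->
  ~ active S J m y C x.
Proof.
move=> Dy hC /activeP[_ xy [i i0]]; have [_ _ h] := KL_coord x hC Dy.
by rewrite h.
Qed.

(** If some index is active, finiteness of the support gives one of maximal length; any reduced word
    for it defines a replacement. *)
Lemma no_replacement_stops y F :
  ~ (exists F', replacement S J T act m y F F') -> stops S J m y F.
Proof.
move=> nrep act_ex; apply: nrep.
have [|x Fx xmax] := @exists_argmax _ l _ (msupp (coords normalized_basis F)) _ act_ex.
  move=> z /activeP[_ _ [i _ nz]].
  by rewrite -mcoeff_neq0; apply/eqP => z0; apply: nz; rewrite /coord z0 mcoeff0.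
have [ss hss] := reduced_word_exists hWS x.
eexists; exists (coords normalized_basis F), x, ss; split=> //.
exact: normalized_coefs_coords.
Qed.

End ParabolicModule.

Theorem mainTheorem2
  (W : groupType) (S : set W) (hWS : coxeter_system S)
  (J : set W) (hJ : (J `<=` S)%classic)
  (H : unitAlgType laurent) (T : W -> H) (hH : hecke_algebra S T)
  (M : lmodType laurent) (act : M -> H -> M) (m : W -> M)
  (hM : parabolic_module S J T act m)
  (bar : M -> M) (hbar : bar_involution T act m bar)
  (C : W -> M)
  (hC : forall y, dist_reps S J y -> is_KL_element S J m bar y (C y))
  (y : W) (hy : dist_reps S J y)
  (ss : seq W) (hss : reduced_word S y ss) :
  (* no infinite run of the procedure starts at the initial value *)
  Acc (fun F' F => replacement S J T act m y F F') (D_word T act m ss) /\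
  (forall F, stage S J T act m y ss F -> stops S J m y F -> F = C y) /\
  (forall F, stage S J T act m y ss F ->
     (~ (exists F', replacement S J T act m y F F')) <-> F = C y).
Proof.
split; first exact: (replacement_Acc hWS hH hM hbar).
have stopC F : stage S J T act m y ss F -> stops S J m y F -> F = C y.
  move=> /(stage_invariantP hWS hH hM hbar hy hss).
  exact: (stops_KL hWS hH hbar hy (hC y hy)).
split=> // F hF; split=> [/(no_replacement_stops hWS hM)|-> [F']]; first exact: stopC.
(* A replacement requires an active index, and [C y] has none. *)
move=> /(replacement_active hWS hH hM hbar)[x [Cx _ _]].
exact: (KL_inactive hWS hM hy (hC y hy)) Cx.
Qed.
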